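(* Let $n\geq 3$ be an integer and let $p(z)=z^n+a_{n-1}z^{n-1}+a_{n-2}z^{n-2}+\ldots+a_1z+a_0$ be a monic polynomial with complex coefficients and $a_0\neq 0$. Set $a_{-1}=0$. If $z\in\mathbb{C}$ is any zero of $p$, then \[\begin{aligned} |z|^2\leq{}& \cos^2 \frac{\pi}{n}+ \frac{1}{4} \left ( |a_{n-1}|+ \sqrt{(1+|a_{n-2}|)^2+ \sum_{j=0,\,j\neq n-2}^{n-1}|a_j|^2}\right)^2\\ & + \frac{1}{4}\sqrt{|a_{n-3}|^2+(1+|a_{n-2}|+|a_{n-4}|)^2+ \sum_{j=0}^{n-4}(|a_{j+1}|+|a_{j-1}|)^2}. \end{aligned}\]
   Context: An empty sum (as $\sum_{j=0}^{n-4}$ when $n=3$) is $0$. *)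

(* Defs.v *)
From HB Require Import structures.
From mathcomp Require Import all_boot all_order all_algebra.
From mathcomp Require Import complex.
From mathcomp Require Import reals trigo.

Set Implicit Arguments.
Unset Strict Implicit.
Unset Printing Implicit Defensive.

Import Order.TTheory GRing.Theory Num.Theory.

Local Open Scope ring_scope.

(* Integer-indexed coefficients, so that the coefficient of index -1 is 0
   and index arithmetic such as n - 4 is not truncated. *)
Definition zcoef (C : nzRingType) (p : {poly C}) (j : int) : C :=
  match j with
  | Posz k => p`_k
  | Negz _ => 0
  end.

(* The modulus as an element of R: the library norm `|x| on R[i] has values
   in R[i], and `|x| = (cmod x)%:C. *)
Definition cmod (R : realType) (x : R[i]) : R := ComplexField.Normc.normc x.

(* Main.v *)
(** Let [M] be the symmetric part of the entrywise modulus of the companion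
    matrix and [y = (r ^ (n-1), ..., r, 1)] with [r = |z|]. The triangle
    inequality applied to [p z = 0] gives [r |y|^2 <= <M y, y>], hence
    [r^2 <= |M|^2]. Split [M = H + K]: [H] is half the adjacency matrix of the
    path on the last [n - 1] coordinates, with [|H| = cos (pi / n)], and [K] is
    supported on the first row and column. Then
    [|M|^2 <= |H|^2 + |K|^2 + |HK + KH|], and since [H] kills the first basis
    vector [e], with [K = al e e^T + e v^T + v e^T] one gets
    [HK + KH = e (Hv)^T + (Hv) e^T], of norm [|Hv|]. *)
Require Import Defs.
From mathcomp Require Import all_boot all_order all_algebra.
From mathcomp Require Import complex.
From mathcomp Require Import reals trigo.
From mathcomp Require Import zify ring lra.

Import Order.TTheory GRing.Theory Num.Theory.

Local Open Scope ring_scope.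

(** * Squares and Cauchy-Schwarz *)

Lemma le_of_sqr_le {R : realFieldType} (x y : R) :
  0 <= y -> x ^+ 2 <= y ^+ 2 -> x <= y.
Proof.
move=> y0; have [x0|x0] := leP x 0; first by move=> _; exact: le_trans x0 y0.
by rewrite ler_pXn2r ?nnegrE // ltW.
Qed.

(** Lagrange's identity: the double sum of squares below is [2 * (F * G - S ^+ 2)]. *)
Lemma sum_CauchySchwarz {R : realFieldType} (I : Type) (s : seq I)
    (f g : I -> R) :
  (\sum_(i <- s) f i * g i) ^+ 2 <=
  (\sum_(i <- s) f i ^+ 2) * (\sum_(i <- s) g i ^+ 2).
Proof.
set S := \sum_(i <- s) f i * g i; set F := \sum_(i <- s) f i ^+ 2.
set G := \sum_(i <- s) g i ^+ 2.
have: 0 <= \sum_(i <- s) \sum_(j <- s) (f i * g j - f j * g i) ^+ 2.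
  by apply: sumr_ge0 => i _; apply: sumr_ge0 => j _; exact: sqr_ge0.
have H i : \sum_(j <- s) (f i * g j - f j * g i) ^+ 2 =
    f i ^+ 2 * G + g i ^+ 2 * F - f i * g i * S *+ 2.
  rewrite /F /G /S !mulr_sumr -sumrMnl -sumrN -!big_split /=.
  by apply: eq_bigr => j _; ring.
rewrite (eq_bigr _ (fun i _ => H i)) big_split big_split /= sumrN sumrMnl.
rewrite -!mulr_suml -/F -/G -/S; lra.
Qed.

(** * Norms of a path, of an arrow, and of their sum *)

(** For [f] vanishing at [0] and [n], this is the adjacency operator of the path [1, ..., n - 1],
    that is, [2 H]. *)
Definition nbr {R : realFieldType} (f : nat -> R) (i : nat) : R :=
  f i.-1 + f i.+1.

Lemma sum_pred_succ {R : realFieldType} (n : nat) (f g : nat -> R) :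
  f 0%N = 0 -> g n = 0 ->
  \sum_(1 <= i < n) f i.-1 * g i = \sum_(1 <= i < n) f i * g i.+1.
Proof.
case: n => [|[|n]] f0 gn; first by rewrite !big_geq.
  by rewrite !big_geq.
rewrite big_add1 /= big_ltn // f0 mul0r add0r.
by rewrite [RHS]big_nat_recr //= gn mulr0 addr0.
Qed.

Lemma nbr_sym {R : realFieldType} (n : nat) (f g : nat -> R) :
  f 0%N = 0 -> f n = 0 -> g 0%N = 0 -> g n = 0 ->
  \sum_(1 <= i < n) nbr f i * g i = \sum_(1 <= i < n) f i * nbr g i.
Proof.
move=> f0 fn g0 gn; rewrite /nbr.
under eq_bigr do rewrite mulrDl.
under [RHS]eq_bigr do rewrite mulrDr.
rewrite !big_split /= sum_pred_succ // addrC; congr (_ + _).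
under eq_bigr do rewrite mulrC.
rewrite -sum_pred_succ //.
by apply: eq_bigr => i _; rewrite mulrC.
Qed.

(* Division by zero giving [0], the weights may vanish at the path's ends. *)
Lemma sqrrD_weighted {R : realFieldType} (a b s t : R) :
  0 <= s -> 0 <= t -> (s = 0 -> a = 0) -> (t = 0 -> b = 0) ->
  (a + b) ^+ 2 <= (s + t) * (a ^+ 2 / s + b ^+ 2 / t).
Proof.
rewrite !le0r => /orP[/eqP->|s0] /orP[/eqP->|t0] sa tb.
- by rewrite sa // tb // !(addr0, expr0n, mul0r) lexx.
- rewrite sa // !add0r expr0n mul0r add0r mulrC divfK //; exact: lt0r_neq0.
- rewrite tb // !addr0 expr0n mul0r addr0 mulrC divfK //; exact: lt0r_neq0.
have -> : (s + t) * (a ^+ 2 / s + b ^+ 2 / t) =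
   (a + b) ^+ 2 + (a * t - b * s) ^+ 2 / (s * t).
  by field; rewrite !lt0r_neq0.
by rewrite lerDl divr_ge0 ?sqr_ge0 // mulr_ge0 // ltW.
Qed.

(* Schur's test with the weights [sin (i pi / n)], the Perron eigenvector of
   the path on [n - 1] vertices. *)
Lemma sum_nbr_sqr_le {R : realType} (n : nat) (y : nat -> R) :
  (1 < n)%N -> y 0%N = 0 -> y n = 0 ->
  \sum_(1 <= i < n) nbr y i ^+ 2 <=
  (2 * cos (pi / n%:R)) ^+ 2 * \sum_(1 <= i < n) y i ^+ 2.
Proof.
move=> n1 y0 yn; set x : R := pi / n%:R; set c := 2 * cos x.
have nn0 : n%:R != 0 :> R by rewrite pnatr_eq0 -lt0n ltnW.
pose s i : R := sin (i%:R * x).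
have s0 : s 0%N = 0 by rewrite /s mul0r sin0.
have sn : s n = 0 by rewrite /s /x mulrC divfK // sinpi.
have x0 : 0 < x by rewrite divr_gt0 ?pi_gt0 // ltr0n ltnW.
have spos i : (0 < i < n)%N -> 0 < s i.
  case/andP=> i0 iN; apply: sin_gt0_pi; rewrite mulr_gt0 ?ltr0n //=.
  have -> : pi = n%:R * x by rewrite mulrC divfK.
  by rewrite ltr_pM2r // ltr_nat.
have snneg i : (i <= n)%N -> 0 <= s i.
  rewrite leq_eqVlt => /orP[/eqP->|iN]; first by rewrite sn.
  by case: i iN => [|i] iN; [rewrite s0 | rewrite ltW // spos].
have sy0 i : (i <= n)%N -> s i = 0 -> y i = 0.
  rewrite leq_eqVlt => /orP[/eqP->//|iN].
  case: i iN => [//|i] iN si.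
  by have := spos i.+1 iN; rewrite si ltxx.
have nbrs i : (0 < i)%N -> nbr s i = c * s i.
  case: i => // i _; rewrite /nbr /s /c /=.
  have -> : i%:R * x = i.+1%:R * x - x by rewrite -natr1; ring.
  have -> : i.+2%:R * x = i.+1%:R * x + x by rewrite -(natr1 i.+1); ring.
  by rewrite sinB sinD; ring.
(* After the weighted bound at each vertex, symmetry moves [nbr] back onto [s], where it is
   multiplication by [c]. *)
pose w i := y i ^+ 2 / s i.
have le1 : \sum_(1 <= i < n) nbr y i ^+ 2 <=
           \sum_(1 <= i < n) c * (s i * nbr w i).
  apply: ler_sum_nat => i /andP[i0 iN].
  rewrite mulrA -nbrs //.
  have i1 : (i.-1 <= n)%N by rewrite (leq_trans (leq_pred _)) // ltnW.
  by apply: sqrrD_weighted; auto.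
apply: le_trans le1 _.
rewrite -mulr_sumr -nbr_sym //; last 2 first.
- by rewrite /w y0 expr0n mul0r.
- by rewrite /w yn expr0n mul0r.
rewrite expr2 -mulrA; suff -> : \sum_(1 <= i < n) nbr s i * w i =
    c * \sum_(1 <= i < n) y i ^+ 2 by [].
rewrite mulr_sumr; apply: eq_big_nat => i iN.
have [i0 _] := andP iN; rewrite nbrs // /w.
by field; rewrite lt0r_neq0 // spos.
Qed.

(* For [b] the larger root of [b ^+ 2 = al * b + V / 4], this says that [b]
   bounds the norm of the symmetric arrow matrix with corner [al] and arm of
   squared length [V / 4]. *)
Lemma arrow_norm_le {R : rcfType} (al t s V q : R) :
  0 <= al -> 0 <= V -> 0 <= q -> s ^+ 2 <= V * q ->
  (al * t + s / 2) ^+ 2 + t ^+ 2 * V / 4 <=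
  ((al + Num.sqrt (al ^+ 2 + V)) / 2) ^+ 2 * (t ^+ 2 + q).
Proof.
move=> al0 V0 q0 sVq; set S := Num.sqrt _.
have S2 : S ^+ 2 = al ^+ 2 + V by rewrite sqr_sqrtr // addr_ge0 // sqr_ge0.
have alS : al <= S.
  by apply: le_of_sqr_le; rewrite ?sqrtr_ge0 // S2 lerDl.
set b := (al + S) / 2.
have b2 : b ^+ 2 = al * b + V / 4 by rewrite /b; nra.
have alb : al <= b by rewrite /b; lra.
(* What the goal asks beyond [b2] and [s ^+ 2 <= V * q]. It is AM-GM after multiplication by [b],
   which can vanish only if [al = 0]. *)
have key : al * (t * s) <= al * ((b - al) * t ^+ 2 + b * q).
  have [->|al1] := eqVneq al 0; first by rewrite !mul0r.
  have bpos : 0 < b by apply: lt_le_trans alb; rewrite lt0r al1.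
  rewrite ler_wpM2l // -(ler_pM2l bpos).
  have -> : b * ((b - al) * t ^+ 2 + b * q) = V / 4 * t ^+ 2 + b ^+ 2 * q.
    have -> : V / 4 = b ^+ 2 - al * b by rewrite b2; ring.
    by ring.
  apply: le_of_sqr_le.
    by rewrite addr_ge0 // mulr_ge0 ?sqr_ge0 // divr_ge0.
  have : (b * t) ^+ 2 * s ^+ 2 <= (b * t) ^+ 2 * (V * q).
    by rewrite ler_wpM2l ?sqr_ge0.
  have := sqr_ge0 (V / 4 * t ^+ 2 - b ^+ 2 * q).
  by nra.
rewrite b2; nra.
Qed.

(* The quadratic form is [<M x, x>], [x = (t, y)], with [M] half the adjacency
   matrix [H] of a path plus an arrow matrix [K] with corner [al] and arm
   [u / 2]; the three terms bound [|H|^2], [|K|^2] and [|HK + KH|], the last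
   because [H] does not act on the corner. *)
Lemma path_arrow_form_le {R : realType} (n : nat) (al t : R) (y u : nat -> R) :
  (1 < n)%N -> 0 <= al ->
  y 0%N = 0 -> y n = 0 -> u 0%N = 0 -> u n = 0 ->
  (1 / 2 * (\sum_(1 <= i < n) nbr y i * y i) + al * t ^+ 2
     + t * \sum_(1 <= i < n) u i * y i) ^+ 2 <=
  (cos (pi / n%:R) ^+ 2
   + 1 / 4 * (al + Num.sqrt (al ^+ 2 + \sum_(1 <= i < n) u i ^+ 2)) ^+ 2
   + 1 / 4 * Num.sqrt (\sum_(1 <= i < n) nbr u i ^+ 2)) *
  (t ^+ 2 + \sum_(1 <= i < n) y i ^+ 2) ^+ 2.
Proof.
move=> n1 al0 y0 yn u0 un.
set q := \sum_(1 <= i < n) y i ^+ 2; set Q := t ^+ 2 + q.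
set s := \sum_(1 <= i < n) u i * y i.
set V := \sum_(1 <= i < n) u i ^+ 2.
set W := \sum_(1 <= i < n) nbr u i ^+ 2.
set B := \sum_(1 <= i < n) nbr y i * y i.
have ge0_sum (f : nat -> R) : 0 <= \sum_(1 <= i < n) f i ^+ 2.
  by apply: sumr_ge0 => i _; exact: sqr_ge0.
have q0 : 0 <= q := ge0_sum _.
have V0 : 0 <= V := ge0_sum _.
have W0 : 0 <= W := ge0_sum _.
have Q0 : 0 <= Q by rewrite addr_ge0 // sqr_ge0.
set D := \sum_(1 <= i < n) nbr y i ^+ 2.
set E := \sum_(1 <= i < n) nbr y i * u i.
(* With [h] below as corner entry, [(h, g)] is [M x]; so [CS] is Cauchy-Schwarz for [<M x, x>], and
   [|M x|^2 = G + h ^+ 2] remains to be bounded. *)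
pose g i := (nbr y i + t * u i) / 2.
set G := \sum_(1 <= i < n) g i ^+ 2.
set T := \sum_(1 <= i < n) g i * y i.
have GE : G = (D + t * E *+ 2 + t ^+ 2 * V) / 4.
  rewrite /G /D /E /V !mulr_sumr -sumrMnl -!big_split /= mulr_suml.
  by apply: eq_bigr => i _; rewrite /g; field.
have TE : T = (B + t * s) / 2.
  rewrite /T /B /s !mulr_sumr -!big_split /= mulr_suml.
  by apply: eq_bigr => i _; rewrite /g; field.
pose h := al * t + s / 2.
have -> : 1 / 2 * B + al * t ^+ 2 + t * s = T + h * t by rewrite TE /h; field.
have TG : T ^+ 2 <= G * q := sum_CauchySchwarz nat _ _ _.
have G0 : 0 <= G := ge0_sum _.
have CS : (T + h * t) ^+ 2 <= (G + h ^+ 2) * Q.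
  have : 2 * (T * (h * t)) <= G * t ^+ 2 + h ^+ 2 * q.
    apply: le_of_sqr_le.
      by rewrite addr_ge0 // mulr_ge0 ?sqr_ge0.
    have : (h * t) ^+ 2 * T ^+ 2 <= (h * t) ^+ 2 * (G * q).
      by rewrite ler_wpM2l ?sqr_ge0.
    have := sqr_ge0 (G * t ^+ 2 - h ^+ 2 * q).
    by nra.
  by rewrite /Q; nra.
apply: le_trans CS _; rewrite expr2 mulrA ler_wpM2r //.
(* Here [G + h ^+ 2] splits into [|H x|^2 = D / 4], [|K x|^2 = h ^+ 2 + t ^+ 2 * V / 4] and the
   cross term [t * E / 2]. *)
have sVq : s ^+ 2 <= V * q := sum_CauchySchwarz nat _ _ _.
have arrow := arrow_norm_le al t s V q al0 V0 q0 sVq.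
have Dle : D <= (2 * cos (pi / n%:R)) ^+ 2 * q by exact: sum_nbr_sqr_le.
(* Moving [nbr] onto [u] gives [|E| <= sqrt (q * W)]; then [|t| * sqrt q <= Q / 2]. *)
have Ele : t * E <= Q / 2 * Num.sqrt W.
  have E2 : E ^+ 2 <= q * W.
    rewrite /E nbr_sym //; exact: sum_CauchySchwarz.
  apply: le_of_sqr_le; first by rewrite mulr_ge0 ?sqrtr_ge0 // divr_ge0.
  rewrite !exprMn sqr_sqrtr //.
  apply: (@le_trans _ _ (t ^+ 2 * (q * W))); first by rewrite ler_wpM2l ?sqr_ge0.
  rewrite mulrA ler_wpM2r // /Q.
  by have := sqr_ge0 (t ^+ 2 - q); nra.
have cQ : cos (pi / n%:R) ^+ 2 * q <= cos (pi / n%:R) ^+ 2 * Q.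
  by rewrite ler_wpM2l ?sqr_ge0 // /Q lerDr sqr_ge0.
rewrite GE -/h in arrow *; rewrite -/Q in arrow.
move: arrow Dle Ele cQ; set cs := cos _; set r1 := Num.sqrt _.
set r2 := Num.sqrt _; nra.
Qed.

(** * Application to the zeros of a polynomial *)

Lemma cmod_root_exp_le {R : realType} (n : nat) (p : {poly R[i]}) (z : R[i]) :
  p \is monic -> size p = n.+1 -> root p z ->
  cmod z ^+ n <= \sum_(0 <= j < n) cmod p`_j * cmod z ^+ j.
Proof.
move=> pmonic sp /rootP; rewrite horner_coef sp big_ord_recr /=.
have -> : p`_n = 1 by rewrite -(monicP pmonic) lead_coefE sp.
rewrite mul1r => /eqP; rewrite addrC addr_eq0 => /eqP zn.
have cmodX (x : R[i]) : `|x| = (cmod x)%:C%C by [].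
rewrite -lecR rmorphXn rmorph_sum /= -cmodX -normrX zn normrN big_mkord.
apply: le_trans (ler_norm_sum _ _ _) _.
by apply: ler_sum => j _; rewrite normrM normrX !cmodX rmorphM rmorphXn.
Qed.

Theorem theorem2p9 (R : realType) (n : nat) (p : {poly R[i]}) (z : R[i])
    (hn : (3 <= n)%N) (hmonic : p \is monic) (hdeg : size p = n.+1)
    (ha0 : p`_0 != 0) (hz : root p z) :
  let a (j : int) : R := cmod (zcoef p j) in
  cmod z ^+ 2 <=
    cos (pi / n%:R) ^+ 2
    + 1 / 4 * (a (n%:Z - 1)
        + Num.sqrt ((1 + a (n%:Z - 2)) ^+ 2
            + \sum_(0 <= j < n | j != (n - 2)%N) a j%:Z ^+ 2)) ^+ 2
    + 1 / 4 * Num.sqrt (a (n%:Z - 3) ^+ 2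
        + (1 + a (n%:Z - 2) + a (n%:Z - 4)) ^+ 2
        + \sum_(0 <= j < (n - 3)%N) (a (j%:Z + 1) + a (j%:Z - 1)) ^+ 2).
Proof.
lazy zeta; set a := fun j : int => cmod (zcoef p j).
case: n hn hdeg => [|[|[|k]]] // _ hdeg.
have cmod_ge0 (x : R[i]) : 0 <= cmod x by rewrite -lecR; exact: (normr_ge0 x).
pose A i := cmod p`_i; pose B i : R := if i is i'.+1 then A i' else 0.
set r := cmod z.
have aA i : a i%:Z = A i by [].
have aB i : a (i%:Z - 1) = B i.
  case: i => [|i]; last by rewrite (_ : i.+1%:Z - 1 = i%:Z) //; lia.
  exact: (@ComplexField.Normc.normc0 R).
have -> : a (k.+3%:Z - 1) = A k.+2 by rewrite aB.
have -> : a (k.+3%:Z - 2) = A k.+1.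
  by rewrite -aA; congr (a _); lia.
have -> : a (k.+3%:Z - 3) = A k.
  by rewrite -aA; congr (a _); lia.
have -> : a (k.+3%:Z - 4) = B k.
  by rewrite -aB; congr (a _); lia.
have rroot := cmod_root_exp_le _ _ _ hmonic hdeg hz; rewrite -/r in rroot.
(* Index [i] stands for the power [i - 1] of [z], so that both ends [0] and [n]
   of the path carry the value [0]. *)
pose y i : R := if (0 < i < k.+3)%N then r ^+ i.-1 else 0.
(* Twice the arm of the arrow. The [1] at the top comes from the companion matrix entry joining the
   corner to the path. *)
pose u i : R :=
  if (i < k.+2)%N then B i else if i == k.+2 then 1 + A k.+1 else 0.
have uB i : (i < k.+2)%N -> u i = B i by rewrite /u => ->.
have utop : u k.+2 = 1 + A k.+1 by rewrite /u ltnn eqxx.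
have un : u k.+3 = 0 by rewrite /u ltnNge leqW //= gtn_eqF.
have yn : y k.+3 = 0 by rewrite /y ltnn andbF.
have ytop : y k.+2 = r ^+ k.+1 by rewrite /y /= ltnS leqnn.
have V_E : A k.+2 ^+ 2 + \sum_(1 <= i < k.+3) u i ^+ 2 =
    (1 + A k.+1) ^+ 2 + \sum_(0 <= j < k.+3 | j != (k.+3 - 2)%N) a j%:Z ^+ 2.
  rewrite big_nat_recr //= utop big_add1 /= subSS subSS subn0.
  rewrite [in RHS]big_mkcond [in RHS]big_nat_recr // [in RHS]big_nat_recr //=.
  rewrite eqxx (gtn_eqF (ltnSn k.+1)) /=.
  rewrite addr0 aA addrC addrCA; congr (_ + _); rewrite addrC; congr (_ + _).
  by apply: eq_big_nat => j jk; rewrite ltn_eqF // uB //; lia.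
(* The last two vertices are split off: the last has one neighbour on the path, and the one before
   it sees the extra [1] in [u k.+2]. *)
have W_E : \sum_(1 <= i < k.+3) nbr u i ^+ 2 =
    A k ^+ 2 + (1 + A k.+1 + B k) ^+ 2
    + \sum_(0 <= j < (k.+3 - 3)%N) (a (j%:Z + 1) + a (j%:Z - 1)) ^+ 2.
  rewrite big_nat_recr // big_nat_recr //= big_add1 /= !subSS subn0 /nbr /=.
  rewrite un addr0 utop !uB //= (addrC (B k)).
  rewrite [LHS]addrC [X in _ + X = _]addrC addrA.
  congr (_ + _); apply: eq_big_nat => j jk.
  rewrite aB (_ : j%:Z + 1 = j.+1%:Z); last by lia.
  by rewrite aA addrC !uB //; lia.
have := path_arrow_form_le k.+3 (A k.+2) (r ^+ k.+2) y u isT (cmod_ge0 _)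
  erefl yn erefl un.
rewrite V_E W_E; set X := _ + _ + _; set G := _ + _ + _.
set q := \sum_(1 <= i < k.+3) y i ^+ 2.
set Q := _ + q => XG.
(* The entry [y 1 = r ^+ 0 = 1] makes [Q] positive. *)
have Qpos : 0 < Q.
  rewrite /Q ltr_wpDl ?sqr_ge0 // /q big_ltn // /y /= expr1n ltr_wpDr //.
  by apply: sumr_ge0 => i _; exact: sqr_ge0.
(* The path sum misses the top term of [r * q], and the extra [1] in [u] supplies it; the rest is
   [rroot] times [r ^+ k.+2]. *)
have rQX : r * Q <= X.
  have nbry : \sum_(1 <= i < k.+3) nbr y i * y i = 2 * (r * (q - y k.+2 ^+ 2)).
    under eq_bigr do rewrite /nbr mulrDl.
    rewrite big_split /= sum_pred_succ //.
    under [X in _ + X]eq_bigr do rewrite mulrC.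
    rewrite -mulr2n [RHS]mulr_natl; congr (_ *+ _).
    rewrite /q [in RHS]big_nat_recr //= addrK mulr_sumr.
    rewrite big_nat_recr //= yn mulr0 addr0; apply: eq_big_nat => i ik.
    have -> : y i.+1 = r * y i.
      by rewrite /y; case: i ik => // i ik; rewrite !ifT ?exprS //; lia.
    by ring.
  have uy : \sum_(1 <= i < k.+3) u i * y i =
      \sum_(0 <= j < k.+2) A j * r ^+ j + r ^+ k.+1.
    rewrite big_nat_recr //= utop ytop [in RHS]big_nat_recr //= mulrDl mul1r.
    rewrite big_add1 /= -addrA (addrC (r ^+ _)); congr (_ + _).
    apply: eq_big_nat => j jk; rewrite uB //.
    by rewrite /y ifT //; lia.
  rewrite /X nbry uy ytop /Q; rewrite big_nat_recr //= in rroot.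
  have := ler_wpM2l (exprn_ge0 k.+2 (cmod_ge0 z)) rroot; rewrite -/r.
  rewrite -/(A _) (exprS r k.+2) (exprS r k.+1).
  set S := \sum_(0 <= j < k.+2) _; lra.
rewrite -(ler_pM2r (exprn_gt0 2 Qpos)); apply: le_trans XG.
have rQ0 : 0 <= r * Q := mulr_ge0 (cmod_ge0 _) (ltW Qpos).
by rewrite -exprMn ler_sqr ?nnegrE ?(le_trans rQ0).
Qed.
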